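(* Let $p$ be an odd prime, let $m$ be a positive integer with $p\nmid m$, and let $t\in\mathbb Z_p$ with $t\not\equiv 0\pmod p$. Write $N=[p/(2m)]$. Then $$\sum_{k=0}^{N}\binom{N}k\binom{[\frac{(m-1)p}{2m}]}k(1-t)^k\equiv t^{N}\sum_{k=0}^{N}\binom{[\frac pm]}{2k}\binom{\frac{p-1}2}k\Big(\frac 1t-1\Big)^k\equiv\begin{cases}P_{[\frac pm]}(\sqrt t)\pmod p&\text{if }2\mid [\frac pm],\\ P_{[\frac pm]}(\sqrt t)/\sqrt t\pmod p&\text{if }2\nmid[\frac pm].\end{cases}$$
   Context: $[x]$ is the greatest integer not exceeding $x$. For a prime $p$, $\mathbb Z_p$ is the set of rationals with denominator coprime to $p$, and $a\equiv b\pmod p$ for $a,b\in\mathbb Z_p$ means $(a-b)/p\in\mathbb Z_p$. For rational $a$ and integer $k\ge0$, $\binom ak=a(a-1)\cdots(a-k+1)/k!$. $P_n(x)$ denotes the Legendre polynomial: $P_0=1$, $P_1=x$, $(n+1)P_{n+1}(x)=(2n+1)xP_n(x)-nP_{n-1}(x)$; equivalently $P_n(x)=2^{-n}\sum_{k=0}^{[n/2]}\binom nk(-1)^k\binom{2n-2k}{n}x^{n-2k}$. For even $n$, $P_n(\sqrt t)$ is a polynomial in $t$, and for odd $n$, $P_n(\sqrt t)/\sqrt t$ is a polynomial in $t$ (coefficients in $\mathbb Z[1/2]$); these are evaluated at $t$.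
   Formalization: The first congruence is proved only for m > 1, since it fails for m = 1 (p = 3, m = 1, t = 2: the first sum is 1, the second expression is -1, and these differ mod 3); the second congruence is proved for every positive m not divisible by p. *)

(* Defs.v *)
From mathcomp Require Export all_boot all_order all_algebra.

Set Implicit Arguments.
Unset Strict Implicit.
Unset Printing Implicit Defensive.

Import Order.TTheory GRing.Theory Num.Theory.
Local Open Scope ring_scope.

(* The localization Z_(p): [denq a] is the reduced denominator of [a]. *)
Definition p_integral (p : nat) : pred rat :=
  fun a => coprime `|denq a|%N p.

(* Congruence is only meaningful between elements of Z_(p), so their
   p-integrality is part of the relation. *)
Definition p_congr (p : nat) (a b : rat) : Prop :=
  [/\ p_integral p a, p_integral p b & p_integral p ((a - b) / p%:R)].

(* Bonnet recurrence
   (n+1) P_{n+1} = (2n+1) x P_n - n P_{n-1}, used with n = k+1. *)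
Fixpoint legendre (n : nat) : {poly rat} :=
  match n with
  | 0 => 1
  | S n' =>
    match n' with
    | 0 => 'X
    | S k => (k.+2)%:R^-1 *:
               ((2 * k.+1 + 1)%:R *: ('X * legendre n') - (k.+1)%:R *: legendre k)
    end
  end.

(* The polynomial in t equal to P_n(sqrt t) for even n and to
   P_n(sqrt t) / sqrt t for odd n; see [legendre_sqrtE]. *)
Definition legendre_sqrt (n : nat) : {poly rat} :=
  if odd n then odd_poly (legendre n) else even_poly (legendre n).

Lemma legendreSS k : legendre k.+2 =
  (k.+2)%:R^-1 *:
    ((2 * k.+1 + 1)%:R *: ('X * legendre k.+1) - (k.+1)%:R *: legendre k).
Proof. by []. Qed.

Lemma coef_legendre_parity n i : odd i != odd n -> (legendre n)`_i = 0.
Proof.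
suff H : forall m, (forall i, odd i != odd m -> (legendre m)`_i = 0) /\
                   (forall i, odd i != odd m.+1 -> (legendre m.+1)`_i = 0).
  by move=> h; apply: (H n).1.
elim=> [|m [IH0 IH1]]; split=> // j.
- by rewrite coef1; case: j.
- by rewrite coefX; case: j => [|[|j]].
- move=> hj; rewrite legendreSS coefZ coefB !coefZ coefXM.
  rewrite IH0 ?mulr0 ?subr0; last by move: hj; rewrite /= negbK.
  case: j hj => [|j] hj; first by rewrite !mulr0.
  by rewrite /= IH1 ?mulr0 //; move: hj => /=; case: (odd j); case: (odd m).
Qed.

Lemma legendre_sqrtE n :
  legendre n = 'X^(odd n) * (legendre_sqrt n \Po 'X^2).
Proof.
rewrite /legendre_sqrt -[LHS]poly_even_odd; case: ifP => on.
  suff -> : even_poly (legendre n) = 0.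
    by rewrite comp_poly0 add0r expr1 mulrC.
  apply/polyP=> i.
  by rewrite coef_even_poly coef0 coef_legendre_parity // odd_double on.
suff -> : odd_poly (legendre n) = 0.
  by rewrite comp_poly0 mul0r addr0 expr0 mul1r.
apply/polyP=> i.
by rewrite coef_odd_poly coef0 coef_legendre_parity //= odd_double on.
Qed.

(* Main.v *)
Require Import Defs.
From mathcomp Require Import all_boot all_order all_algebra.
From mathcomp Require Import ring zify.

Import GRing.Theory Num.Theory.
Local Open Scope ring_scope.

(* Write n = [p/m], N = [p/(2m)] = [n/2] and (a choose k) for the generalized
   binomial coefficient.  Replacing 1 by x^2 - (x^2 - 1) in front of P_(n-1), the
   Bonnet recurrence becomes homogeneous in x and 1 - x^2, and yields
     P_n(x) = sum_k C(n,2k) (-1/2 choose k) x^(n-2k) (1-x^2)^k.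
   As (p-1)/2 = -1/2 mod p, this is the second congruence.  Moreover
   C(n,2k) (-1/2 choose k) = (-1)^k C(N,k) (n-N-1/2 choose k), and a
   Vandermonde-type summation re-expands the right-hand side, after x^2 = t, as
     sum_k C(N,k) (N-n-1/2 choose k) (1-t)^k.
   When m > 1 and p does not divide m, [(m-1)p/(2m)] = N-n-1/2 + p/2, which gives
   the first congruence. *)

(** * Arithmetic and congruences in the localization at p *)

Lemma p_integral_frac p x (a : int) (d : nat) :
  coprime d p -> d%:R != 0 :> rat -> x = a%:~R / d%:R -> p_integral p x.
Proof.
move=> cdp d0 xE; apply: coprime_dvdl cdp.
have: numq x * d%:Z = a * denq x.
  apply: (@intr_inj rat); rewrite !rmorphM /= numqE -[d%:Z%:~R]/(d%:R).
  by rewrite xE mulrAC divfK // mulrC.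
move/(congr1 absz); rewrite !abszM /= => /esym E.
have: (`|denq x| %| `|numq x| * d)%N by rewrite -E dvdn_mull.
by rewrite Gauss_dvdr // coprime_sym coprime_num_den.
Qed.

Lemma p_integralP p x :
  reflect (exists (a : int) (d : nat),
    [/\ coprime d p, d%:R != 0 :> rat & x = a%:~R / d%:R]) (p_integral p x).
Proof.
apply: (iffP idP) => [ix|[a [d [cd d0 xE]]]].
  2: exact: p_integral_frac cd d0 xE.
exists (numq x), `|denq x|%N; split=> //.
  by rewrite pnatr_eq0 absz_eq0 denq_eq0.
by rewrite -[X in _ / X]/((`|denq x|%N : int)%:~R) absz_denq divq_num_den.
Qed.

Section Congruences.
Variable p : nat.
Implicit Types a b c d : rat.

Lemma p_integral_nat n : p_integral p n%:R.
Proof.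
by apply/p_integralP; exists n, 1%N; rewrite coprime1n divr1.
Qed.

Lemma p_integral_divn (n d : nat) : prime p -> coprime d p -> p_integral p (n%:R / d%:R).
Proof.
move=> p_prime cdp; apply/p_integralP; exists n, d; split=> //.
rewrite pnatr_eq0; apply: contraTneq cdp => ->.
by rewrite /coprime gcd0n neq_ltn prime_gt1 ?orbT.
Qed.

Lemma p_integralD a b : p_integral p a -> p_integral p b -> p_integral p (a + b).
Proof.
move=> /p_integralP[u [d [cd d0 ->]]].
move=> /p_integralP[v [e [ce e0 ->]]].
apply/p_integralP; exists (u * e + v * d), (d * e)%N.
split; first by rewrite coprimeMl cd.
  by rewrite natrM mulf_neq0.
by rewrite addf_div // natrM rmorphD !rmorphM.
Qed.

Lemma p_integralM a b : p_integral p a -> p_integral p b -> p_integral p (a * b).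
Proof.
move=> /p_integralP[u [d [cd d0 ->]]].
move=> /p_integralP[v [e [ce e0 ->]]].
apply/p_integralP; exists (u * v), (d * e)%N.
split; first by rewrite coprimeMl cd.
  by rewrite natrM mulf_neq0.
by rewrite mulf_div natrM rmorphM.
Qed.

Lemma p_integralN a : p_integral p a -> p_integral p (- a).
Proof. by rewrite /p_integral denqN. Qed.

Lemma p_integralX a k : p_integral p a -> p_integral p (a ^+ k).
Proof.
move=> ia; elim: k => [|k IH]; first exact: (p_integral_nat 1).
by rewrite exprS p_integralM.
Qed.

Lemma p_congr_refl a : p_integral p a -> p_congr p a a.
Proof. by move=> ia; split=> //; rewrite subrr mul0r (p_integral_nat 0). Qed.

Lemma p_congr_sym a b : p_congr p a b -> p_congr p b a.
Proof. by case=> ia ib iab; split=> //; rewrite -opprB mulNr p_integralN. Qed.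

Lemma p_congr_trans b a c : p_congr p a b -> p_congr p b c -> p_congr p a c.
Proof.
case=> ia ib iab [_ ic ibc]; split=> //.
by rewrite -(subrKA b) mulrDl p_integralD.
Qed.

Lemma p_congrD a b c d :
  p_congr p a b -> p_congr p c d -> p_congr p (a + c) (b + d).
Proof.
case=> ia ib iab [ic id icd]; split; rewrite ?p_integralD //.
by rewrite opprD addrACA mulrDl p_integralD.
Qed.

Lemma p_congrM a b c d :
  p_congr p a b -> p_congr p c d -> p_congr p (a * c) (b * d).
Proof.
case=> ia ib iab [ic id icd]; split; [exact: p_integralM..|].
have -> : (a * c - b * d) / p%:R = a * ((c - d) / p%:R) + (a - b) / p%:R * d.
  by ring.
by apply: p_integralD => //; apply: p_integralM.
Qed.

(** The difference divided by p is 1/2, which is integral for odd p. This trades integer parts for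
    the half-integers at which the Legendre expansions are exact. *)
Lemma p_congr_sub_half v : prime p -> odd p ->
  p_congr p v%:R (v%:R - p%:R / 2).
Proof.
move=> p_prime p_odd; have p0 : p%:R != 0 :> rat by rewrite pnatr_eq0 -lt0n prime_gt0.
have i2 u : p_integral p (u%:R / 2%:R).
  by apply: p_integral_divn => //; rewrite coprime2n.
split; first exact: p_integral_nat.
  by apply/p_integralD/p_integralN/i2; exact: p_integral_nat.
have -> : (v%:R - (v%:R - p%:R / 2)) / p%:R = 1 / 2 :> rat by field.
exact: (i2 1).
Qed.

Lemma p_congr_sum (r : seq nat) (F G : nat -> rat) :
  (forall k, k \in r -> p_congr p (F k) (G k)) ->
  p_congr p (\sum_(k <- r) F k) (\sum_(k <- r) G k).
Proof.
move=> FG; rewrite big_seq [X in p_congr p _ X]big_seq.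
apply: (big_ind2 (p_congr p)) => //; last by move=> *; exact: p_congrD.
exact/p_congr_refl/(p_integral_nat 0).
Qed.

End Congruences.

(** * Generalized binomial coefficients *)

Definition gbin (a : rat) (k : nat) : rat :=
  (\prod_(i < k) (a - i%:R)) / k`!%:R.

Lemma gbin0 a : gbin a 0 = 1.
Proof. by rewrite /gbin big_ord0 divr1. Qed.

Lemma natr1_neq0 k : k%:R + 1 != 0 :> rat.
Proof. by rewrite natr1 pnatr_eq0. Qed.

Lemma gbinS a k : gbin a k.+1 = gbin a k * (a - k%:R) / (k%:R + 1).
Proof.
rewrite /gbin big_ord_recr /= factS natrM -natr1.
have k0 : k`!%:R != 0 :> rat by rewrite pnatr_eq0 -lt0n fact_gt0.
by field; rewrite k0 natr1_neq0.
Qed.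

Lemma gbin_nat n k : gbin n%:R k = 'C(n, k)%:R.
Proof.
elim: k => [|k IH]; first by rewrite gbin0 bin0.
rewrite gbinS IH; apply: (canLR (mulfK (natr1_neq0 k))).
have [le_kn|lt_nk] := leqP k n; last by rewrite !bin_small ?mul0r // leqW.
by rewrite natr1 -natrB // -!natrM mulnC -mul_bin_left mulnC.
Qed.

Lemma gbin_pascal a k : gbin (a + 1) k.+1 = gbin a k.+1 + gbin a k.
Proof.
elim: k => [|k IH]; first by rewrite !gbinS !gbin0; field.
rewrite gbinS IH [gbin a k.+2]gbinS [gbin a k.+1]gbinS -natr1.
by field; rewrite natr1_neq0 (natr1 k) natr1_neq0.
Qed.

Lemma gbin_diag a k : gbin (a + 1) k.+1 = (a + 1) / (k%:R + 1) * gbin a k.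
Proof. by rewrite gbin_pascal gbinS; field; rewrite natr1_neq0. Qed.

(** Upper negation: it turns the moving argument [a + k%:R] produced by [sum_bin_gbin] into a fixed
    one. *)
Lemma gbin_neg a k : gbin (- a - 1) k = (-1) ^+ k * gbin (a + k%:R) k.
Proof.
elim: k => [|k IH]; first by rewrite !gbin0 mulr1.
rewrite gbinS IH -natr1 addrA gbin_diag exprS.
by field; rewrite natr1_neq0.
Qed.

(** Since [k < p], the factors 1, ..., k of the factorial are units modulo p, so the congruence
    survives each division in [gbinS]. *)
Lemma p_congr_gbin p a b k : prime p -> (k < p)%N ->
  p_congr p a b -> p_congr p (gbin a k) (gbin b k).
Proof.
move=> p_prime; elim: k => [|k IH] lt_kp ab.
  by rewrite !gbin0; exact: (p_congr_refl _ _ (p_integral_nat _ 1)).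
rewrite !gbinS; apply: p_congrM => //; first apply: p_congrM => //.
- exact: IH (ltnW lt_kp) ab.
- apply: p_congrD => //; apply/p_congr_refl/p_integralN => //.
  exact: p_integral_nat.
apply: p_congr_refl => //; rewrite natr1 -div1r.
apply: (p_integral_divn _ 1) => //.
by rewrite coprime_sym prime_coprime // gtnNdvd.
Qed.

(** * Binomial summation and duplication identities *)

Lemma sum_bin_recr N (f : nat -> rat) :
  \sum_(0 <= k < N.+2) 'C(N.+1, k)%:R * f k =
  \sum_(0 <= k < N.+1) 'C(N, k)%:R * (f k + f k.+1).
Proof.
rewrite big_nat_recl // bin0 mul1r.
under eq_bigr => k _ do rewrite binS natrD mulrDl.
under [RHS]eq_bigr => k _ do rewrite mulrDr.
rewrite !big_split /= addrA; congr (_ + _).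
rewrite big_nat_recr //= bin_small // mul0r addr0.
by rewrite [RHS]big_nat_recl // bin0 mul1r.
Qed.

(* The shift [j] makes the induction on [N] close up. *)
Lemma sum_bin_gbin N j a y :
  \sum_(0 <= k < N.+1) 'C(N, k)%:R * (gbin a (k + j) * (1 + y) ^+ (N - k) * y ^+ k) =
  \sum_(0 <= k < N.+1) 'C(N, k)%:R * (gbin (a + k%:R) (k + j) * y ^+ k).
Proof.
elim: N j => [|N IH] j; first by rewrite !big_nat1 !expr0 addr0 mulr1.
rewrite !sum_bin_recr.
(* The terms [f k] gain a factor 1 + y from the exponent N + 1 - k; the terms [f k.+1] gain a factor
   y and raise the shift to [j.+1]. *)
transitivity
  ((1 + y) * (\sum_(0 <= k < N.+1)
     'C(N, k)%:R * (gbin a (k + j) * (1 + y) ^+ (N - k) * y ^+ k)) +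
   y * (\sum_(0 <= k < N.+1)
     'C(N, k)%:R * (gbin a (k + j.+1) * (1 + y) ^+ (N - k) * y ^+ k))).
  rewrite !mulr_sumr -big_split; apply: eq_big_nat => k /andP[_ le_kN] /=.
  by rewrite subSS subSn // !exprS addnS addSn; ring.
(* The two contributions in y^(k+1) merge by Pascal's rule, moving the argument to a + k + 1. *)
rewrite !IH !mulr_sumr -big_split; apply: eq_bigr => k _ /=.
by rewrite addSn -natr1 addrA gbin_pascal addnS exprS; ring.
Qed.

(** Passing from k to k + 1 multiplies both sides by -(n-2k)(n-2k-1)/(4(k+1)^2). Of n-2k and n-2k-1,
    the even one feeds ['C(n./2, k)] and the odd one the half-integer binomial. *)
Lemma bin_double_gbin n k :
  'C(n, 2 * k)%:R * gbin (- (1 / 2)) k =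
  (-1) ^+ k * 'C(n./2, k)%:R * gbin (n%:R - (n./2)%:R - 1 / 2) k.
Proof.
elim: k => [|k IH]; first by rewrite !bin0 !gbin0 mulr1.
have nE : n%:R = (odd n)%:R + 2 * (n./2)%:R :> rat.
  by rewrite -{1}(odd_double_half n) natrD -mul2n natrM.
have -> : 'C(n, 2 * k.+1)%:R = 'C(n, 2 * k)%:R * (n%:R - 2 * k%:R)
    * (n%:R - 2 * k%:R - 1) / ((2 * k%:R + 1) * (2 * k%:R + 1 + 1)) :> rat.
  rewrite -!gbin_nat mulnS !add2n !gbinS -natr1 natrM.
  have := natr1_neq0 (2 * k); have := natr1_neq0 (2 * k).+1.
  by rewrite -natr1 natrM => ? ?; field; apply/andP.
rewrite -[in RHS]gbin_nat !gbinS gbin_nat.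
transitivity ('C(n, 2 * k)%:R * gbin (- (1 / 2)) k *
  ((n%:R - 2 * k%:R) * (n%:R - 2 * k%:R - 1) / ((2 * k%:R + 1) * (2 * k%:R + 1 + 1)) *
   (- (1 / 2) - k%:R) / (k%:R + 1))); first by ring.
rewrite IH exprS nE.
have := natr1_neq0 (2 * k); have := natr1_neq0 (2 * k).+1.
rewrite -natr1 natrM => h1 h2.
by case: (odd n) => /=; field; rewrite h1 h2 natr1_neq0.
Qed.

(** * Expansion of Legendre polynomials in x and 1 - x^2 *)

Definition legendre_coef n k : rat := 'C(n, 2 * k)%:R * gbin (- (1 / 2)) k.

Lemma legendre_coef0 n : legendre_coef n 0 = 1.
Proof. by rewrite /legendre_coef bin0 gbin0 mulr1. Qed.

Lemma legendre_coef_small n k : (n < 2 * k)%N -> legendre_coef n k = 0.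
Proof. by move=> lt_n; rewrite /legendre_coef bin_small ?mul0r. Qed.

(** This is the Bonnet recurrence with P_n split as x^2 P_n + (1 - x^2) P_n, read off at (1 -
    x^2)^(k+1). *)
Lemma legendre_coef_rec n k :
  n.+2%:R * legendre_coef n.+2 k.+1 =
  (2 * n.+1 + 1)%:R * legendre_coef n.+1 k.+1
  - n.+1%:R * (legendre_coef n k.+1 + legendre_coef n k).
Proof.
rewrite /legendre_coef mulnS !add2n -!gbin_nat natrD natrM -!natr1.
rewrite !gbin_pascal !gbinS -natr1 natrM.
have := natr1_neq0 (2 * k); have := natr1_neq0 (2 * k).+1.
by rewrite -natr1 natrM => h1 h2; field; rewrite h1 h2 natr1_neq0.
Qed.

Definition legendre_term n k : {poly rat} :=
  (legendre_coef n k)%:P * ('X^(n - 2 * k) * (1 - 'X^2) ^+ k).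

(** When n < 2k the exponent n - 2k truncates to 0, but then the coefficient vanishes. *)
Lemma legendre_term_shift n j k :
  'X^j * legendre_term n k =
  (legendre_coef n k)%:P * ('X^(n + j - 2 * k) * (1 - 'X^2) ^+ k).
Proof.
rewrite /legendre_term; have [lt_n|le_n] := ltnP n (2 * k).
  by rewrite legendre_coef_small // !mul0r mulr0.
by rewrite -addnBAC // exprD; ring.
Qed.

Lemma legendre_term_rec n k :
  n.+2%:R *: legendre_term n.+2 k.+1 =
  (2 * n.+1 + 1)%:R *: ('X^1 * legendre_term n.+1 k.+1)
  - n.+1%:R *: ('X^2 * legendre_term n k.+1 + (1 - 'X^2) * legendre_term n k).
Proof.
rewrite !legendre_term_shift /legendre_term exprS.
have [-> -> ->] : [/\ n.+2 - 2 * k.+1 = n - 2 * k,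
  n.+1 + 1 - 2 * k.+1 = n - 2 * k & n + 2 - 2 * k.+1 = n - 2 * k]%N by split; lia.
have comb (u v w a b c d : rat) (x y z : {poly rat}) : u * a = v * b - w * (c + d) ->
    u *: (a%:P * (x * (y * z))) =
    v *: (b%:P * (x * (y * z))) -
    w *: (c%:P * (x * (y * z)) + y * (d%:P * (x * z))).
  by move=> /(congr1 polyC); rewrite !(polyCB, polyCM, polyCD) -!mul_polyC mulrA => ->; ring.
exact: comb (legendre_coef_rec n k).
Qed.

Lemma legendre_expansion n K : (n < 2 * K)%N ->
  legendre n = \sum_(0 <= k < K) legendre_term n k.
Proof.
suff H m : (forall K, (m < 2 * K)%N ->
      legendre m = \sum_(0 <= k < K) legendre_term m k) /\
    (forall K, (m.+1 < 2 * K)%N ->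
      legendre m.+1 = \sum_(0 <= k < K) legendre_term m.+1 k).
  exact: (H n).1.
have term0 i : legendre_term i 0 = 'X^i.
  by rewrite /legendre_term legendre_coef0 muln0 subn0 mul1r mulr1.
have low i K' : (i < 2)%N -> (i < 2 * K')%N ->
    \sum_(0 <= k < K') legendre_term i k = 'X^i.
  case: K' => [//|K'] lt_i2 _.
  rewrite big_nat_recl // term0 big1 ?addr0 // => k _.
  by rewrite /legendre_term legendre_coef_small ?mul0r //; lia.
elim: m => [|m [IH0 IH1]]; first by split=> L ltL; rewrite low.
split=> // -[//|L] ltL.
rewrite legendreSS; apply: (canLR (scalerK _)); first by rewrite pnatr_eq0.
(* The free bound K lets P_m be summed to two lengths; the shorter sum, times 1 - x^2, lines up with
   the others after an index shift by one. *)
have legE : legendre m = 'X^2 * \sum_(0 <= k < L.+1) legendre_term m k +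
     (1 - 'X^2) * \sum_(0 <= k < L) legendre_term m k.
  by rewrite -!IH0; [ring | lia | lia].
rewrite legE (IH1 L.+1); last by lia.
rewrite !(@big_nat_recl _ _ _ L) // [RHS]scalerDr [in RHS]scaler_sumr.
under [in RHS]eq_bigr => k _ do rewrite legendre_term_rec.
rewrite sumrB -!scaler_sumr big_split -!mulr_sumr /= !term0 !exprS.
(* This settles the k = 0 terms, which are pure powers of x. *)
have -> : m.+2%:R = (2 * m.+1 + 1)%:R - m.+1%:R :> rat.
  by rewrite -natrB; [congr _%:R; lia | lia].
move: (_%:R : rat) (_%:R : rat) => a b; rewrite -!mul_polyC polyCB.
by ring.
Qed.

Lemma legendre_sqrt_expansion n :
  legendre_sqrt n = \sum_(0 <= k < n./2.+1)
    (legendre_coef n k)%:P * ('X^(n./2 - k) * (1 - 'X) ^+ k).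
Proof.
set G := RHS.
have : legendre_sqrt n \Po 'X^2 = G \Po 'X^2.
  have X0 : 'X^(odd n) != 0 :> {poly rat} by rewrite monic_neq0 ?monicXn.
  apply: (mulfI X0); rewrite -legendre_sqrtE.
  rewrite (@legendre_expansion _ n./2.+1); last by lia.
  rewrite rmorph_sum mulr_sumr; apply: eq_big_nat => k /andP[_ le_k].
  rewrite /legendre_term; move: (legendre_coef n k) => c.
  rewrite !rmorphM !rmorphXn rmorphB rmorph1 /= comp_polyC comp_polyX -exprM.
  have -> : (n - 2 * k = odd n + 2 * (n./2 - k))%N by lia.
  by rewrite exprD; ring.
(* Substituting X^2 is injective: coefficient i reappears at position 2i. *)
move/polyP=> E; apply/polyP=> i; have := E (i * 2)%N.
by rewrite !coef_comp_poly_Xn // dvdn_mull // mulnK.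
Qed.

Lemma horner_legendre_sqrt n t :
  (legendre_sqrt n).[t] = \sum_(0 <= k < n./2.+1)
    legendre_coef n k * (t ^+ (n./2 - k) * (1 - t) ^+ k).
Proof.
rewrite legendre_sqrt_expansion horner_sum; apply: eq_bigr => k _.
by rewrite !hornerE.
Qed.

(** Apply [sum_bin_gbin] with y = t - 1 and shift 0: then 1 + y = t, and the signs from
    [bin_double_gbin] turn (1 - t)^k into y^k. *)
Lemma horner_legendre_sqrt_bin n t :
  (legendre_sqrt n).[t] = \sum_(0 <= k < n./2.+1)
    'C(n./2, k)%:R * gbin ((n./2)%:R - n%:R - 1 / 2) k * (1 - t) ^+ k.
Proof.
rewrite horner_legendre_sqrt.
pose a : rat := n%:R - (n./2)%:R - 1 / 2.
transitivity (\sum_(0 <= k < n./2.+1) 'C(n./2, k)%:R *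
   (gbin a (k + 0) * (1 + (t - 1)) ^+ (n./2 - k) * (t - 1) ^+ k)).
  apply: eq_bigr => k _; rewrite /legendre_coef bin_double_gbin addn0.
  by rewrite [1 + (t - 1)]addrC subrK -(opprB 1 t) [(- (1 - t)) ^+ k]exprNn /a; ring.
rewrite sum_bin_gbin; apply: eq_bigr => k _.
have -> : (n./2)%:R - n%:R - 1 / 2 = - a - 1 by rewrite /a; field.
by rewrite gbin_neg -(opprB 1 t) [(- (1 - t)) ^+ k]exprNn addn0; ring.
Qed.

(** * Integer parts, and the two congruences *)

Lemma half_div_complement (p m : nat) : odd p -> (1 < m)%N -> ~~ (m %| p)%N ->
  p = (2 * (((m - 1) * p) %/ (2 * m)) + 2 * (p %/ m) + 1 - 2 * (p %/ m)./2)%N.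
Proof.
move=> p_odd m_gt1 ndvd_mp.
set n := (p %/ m)%N; set M := (_ %/ (2 * m))%N.
have r_gt0 : (0 < p %% m)%N by rewrite lt0n.
have r_lt : (p %% m < m)%N by rewrite ltn_mod; lia.
have pE := divn_eq p m; rewrite -/n in pE.
have nE := odd_double_half n.
have [h hE] : exists h, p = h.*2.+1.
  by exists p./2; have := odd_double_half p; rewrite p_odd add1n.
have le_nh : (n <= h)%N.
  by rewrite (leq_trans (leq_div2l p (_ : 0 < 2)%N m_gt1)) // divn2 hE /= uphalf_double.
have [K KE] : exists K, h = (K + (n - n./2))%N.
  by exists (h - (n - n./2))%N; lia.
have EK : (2 * h = 2 * K + n + odd n)%N by lia.
have EM : (m * p = 2 * (m * K) + n * m + m * odd n + m)%N.
  have -> : p = (2 * K + n + odd n).+1 by lia.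
  by rewrite mulnS !mulnDr; lia.
have EP : ((m - 1) * p = m * p - p)%N by rewrite mulnBl mul1n.
have em : (m * odd n = if odd n then m else 0)%N.
  by case: (odd n); rewrite ?muln1 ?muln0.
(* With r = [p %% m], (m-1)p - 2mK equals m * odd n + m - r, which lies strictly between 0 and 2m
   because 0 < r < m. *)
suff -> : M = K by lia.
clear nE hE le_nh KE EK.
apply/eqP; rewrite eqn_leq; apply/andP; split.
  rewrite -ltnS ltn_divLR; last by lia.
  by move: em EM; rewrite EP; case: (odd n) => -> EM; lia.
rewrite leq_divRL; last by lia.
by move: em EM; rewrite EP; case: (odd n) => -> EM; lia.
Qed.

Theorem theorem2p1 (p m : nat) (t : rat)
    (p_prime : prime p) (p_odd : odd p)
    (m_gt0 : (0 < m)%N) (p_ndvd_m : ~~ (p %| m)%N)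
    (t_int : p_integral p t) (t_n0 : ~ p_congr p t 0) :
  let N := (p %/ (2 * m))%N in
  let S1 := \sum_(0 <= k < N.+1)
    ('C(N, k))%:R * ('C(((m - 1) * p) %/ (2 * m), k))%:R * (1 - t) ^+ k in
  let S2 := t ^+ N * \sum_(0 <= k < N.+1)
    ('C(p %/ m, 2 * k))%:R * ('C((p - 1) %/ 2, k))%:R * (1 / t - 1) ^+ k in
  let L := (legendre_sqrt (p %/ m)).[t] in
  ((1 < m)%N -> p_congr p S1 S2) /\ p_congr p S2 L.
Proof.
move=> N S1 S2 L; set n := (p %/ m)%N in S2 L *.
have NE : N = n./2 by rewrite /N /n -divn2 -divnMA mulnC.
have lt_Np : (N < p)%N by rewrite ltn_Pdiv ?prime_gt0 //; lia.
have t0 : t != 0.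
  apply: contra_not_neq t_n0 => ->.
  exact: (p_congr_refl _ _ (p_integral_nat _ 0)).
have it k : p_integral p ((1 - t) ^+ k).
  apply/p_integralX/p_integralD/p_integralN => //.
  exact: (p_integral_nat _ 1).
have S2L : p_congr p S2 L.
  rewrite /L horner_legendre_sqrt -NE /S2 mulr_sumr.
  apply: p_congr_sum => // k; rewrite mem_index_iota /= ltnS => le_kN.
  have -> : t ^+ N * ('C(n, 2 * k)%:R * 'C((p - 1) %/ 2, k)%:R * (1 / t - 1) ^+ k)
     = 'C(n, 2 * k)%:R * 'C((p - 1) %/ 2, k)%:R * (t ^+ (N - k) * (1 - t) ^+ k).
    have -> : 1 / t - 1 = (1 - t) / t by field.
    rewrite -{1}(subnK le_kN) exprD expr_div_n.
    by field; rewrite expf_neq0.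
  apply: p_congrM => //; last first.
    by apply/p_congr_refl/p_integralM => //; apply: p_integralX.
  apply: p_congrM => //; first exact/p_congr_refl/p_integral_nat.
  rewrite -gbin_nat; apply: p_congr_gbin => //; first exact: leq_ltn_trans lt_Np.
  have -> : - (1 / 2) = ((p - 1) %/ 2)%:R - p%:R / 2 :> rat.
    have {2}-> : p = (2 * ((p - 1) %/ 2) + 1)%N by lia.
    by rewrite natrD natrM; field.
  exact: p_congr_sub_half.
(* Both sums are compared with L. For m = 1 the first sum is 1 while L is congruent to t^((p-1)/2),
   hence the restriction to m > 1. *)
split=> // m_gt1; apply: p_congr_trans (p_congr_sym _ _ _ S2L) => //.
rewrite /L horner_legendre_sqrt_bin -NE.
apply: p_congr_sum => // k; rewrite mem_index_iota /= ltnS => le_kN.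
apply: p_congrM => //; last exact: p_congr_refl.
apply: p_congrM => //; first exact/p_congr_refl/p_integral_nat.
rewrite -gbin_nat; apply: p_congr_gbin => //; first exact: leq_ltn_trans lt_Np.
have pE : p%:R = 2 * (((m - 1) * p) %/ (2 * m))%:R + 2 * n%:R + 1 - 2 * N%:R :> rat.
  rewrite {1}(@half_div_complement p m) //.
    rewrite -/n -NE natrB; first by rewrite 2!natrD !natrM.
    rewrite addn1 ltnW // ltnS.
    by rewrite (leq_trans _ (leq_addl _ _)) // leq_mul2l NE -divn2 leq_div.
  apply: contraNN p_ndvd_m => /(primeP p_prime).2 /orP[/eqP m1|/eqP->//].
  by rewrite m1 in m_gt1.
have -> : N%:R - n%:R - 1 / 2 = (((m - 1) * p) %/ (2 * m))%:R - p%:R / 2 :> rat.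
  by rewrite pE; field.
exact: p_congr_sub_half.
Qed.
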